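(* For every connected graph $G$ the following assertions are equivalent: (i) The end space of $G$ is not second countable. (ii) $G$ has an uncountable star-decomposition of finite adhesion such that in every leaf part there lives an end of $G$. In particular, the end space of $G$ contains uncountably many pairwise disjoint open sets.
   Context: The ''in particular'' clause in (ii) records a consequence of the existence of such a star-decomposition; the open sets are understood to be non-empty. Graphs may be infinite of any cardinality. A ray is a one-way infinite path. Two rays in $G$ are equivalent if no finite set of vertices separates them; the equivalence classes are the ends of $G$, and $\Omega(G)$ is the set of ends. For finite $X\subseteq V(G)$ and $\omega\in\Omega(G)$, $C(X,\omega)$ is the unique component of $G-X$ that contains a tail of every ray in $\omega$. The end space of $G$ is $\Omega(G)$ with the topology having as a basis all sets $\Omega(X,C)=\{\omega\in\Omega(G): C(X,\omega)=C\}$, with $X\subseteq V(G)$ finite and $C$ a component of $G-X$. Second countable means having a countable base. A tree-decomposition of $G$ is a pair $(T,\mathcal V)$ of a tree $T$ and a family $\mathcal V=(V_t)_{t\in V(T)}$ of parts $V_t\subseteq V(G)$ such that $V(G)=\bigcup_t V_t$, every edge of $G$ has both endvertices in some $V_t$, and $V_{t_1}\cap V_{t_3}\subseteq V_{t_2}$ whenever $t_2$ lies on the path $t_1Tt_3$. It has finite adhesion if $V_{t_1}\cap V_{t_2}$ is finite for every edge $t_1t_2$ of $T$. An uncountable star-decomposition is a tree-decomposition whose tree is a star $K_{1,\kappa}$ with $\kappa$ an uncountable cardinal; the parts of its leaves are the leaf parts. If $(T,\mathcal V)$ has finite adhesion, an end lives in a part $V_t$ if some (equivalently, every) ray in that end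 has infinitely many vertices in $V_t$. *)

(* Defs.v *)
From HB Require Import structures.
From mathcomp Require Import all_boot all_order.
From mathcomp Require Import all_classical all_analysis.

Set Implicit Arguments.
Unset Strict Implicit.
Unset Printing Implicit Defensive.

Local Open Scope classical_set_scope.

(* Classically, every type is a choiceType and every relation is
   boolean-valued, so neither is a restriction. *)
Record sgraph := SGraph {
  vert :> choiceType;
  adj : rel vert;
  adj_sym : symmetric adj;
  adj_irr : irreflexive adj }.

(* There is an [x]-[y] walk in the induced subgraph G[A]; for
   [A = ~` X] this is reachability in G - X. *)
Definition linked (G : sgraph) (A : set G) (x y : G) : Prop :=
  exists p : seq G,
    [/\ path (@adj G) x p, last x p = y & forall z, z \in x :: p -> A z].

Definition gconnected (G : sgraph) : Prop :=
  [set: G] !=set0 /\ forall x y : G, linked [set: G] x y.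

Definition is_component (G : sgraph) (X C : set G) : Prop :=
  exists2 x, ~ X x & C = [set y | linked (~` X) x y].

(* Every [A]-[B] path meets [X]; allowing walks instead of paths makes no
   difference. *)
Definition separates (G : sgraph) (X A B : set G) : Prop :=
  forall a b, A a -> B b -> ~ linked (~` X) a b.

Record ray (G : sgraph) := Ray {
  ray_vert :> nat -> G;
  ray_inj : injective ray_vert;
  ray_adj : forall n, adj (ray_vert n) (ray_vert n.+1) }.

Definition ray_equiv (G : sgraph) (R S : ray G) : Prop :=
  forall X : set G, finite_set X -> ~ separates X (range R) (range S).

(* An end is an equivalence class of rays. *)
Record ends (G : sgraph) := End {
  end_rays : set (ray G);
  end_class : exists R, end_rays = [set S | ray_equiv R S] }.

HB.instance Definition _ (G : sgraph) := gen_eqMixin (ends G).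
HB.instance Definition _ (G : sgraph) := gen_choiceMixin (ends G).

Definition tail_in (G : sgraph) (R : ray G) (C : set G) : Prop :=
  exists n, forall m, (n <= m)%N -> C (R m).

(* C(X, w), meaningful for finite [X]; well defined by [end_compP] and
   [end_comp_eq] below. *)
Definition end_comp (G : sgraph) (X : set G) (w : ends G) : set G :=
  xget set0 [set C | is_component X C /\ forall R, end_rays w R -> tail_in R C].

(* Omega(X, C), for [XC] the pair (X, C). *)
Definition end_basic (G : sgraph) (XC : set G * set G) : set (ends G) :=
  [set w | end_comp XC.1 w = XC.2].

Definition end_basic_index (G : sgraph) : set (set G * set G) :=
  [set XC | finite_set XC.1 /\ is_component XC.1 XC.2].

Section EndComponents.
Variable G : sgraph.
Implicit Types (X Y C D : set G) (R S : ray G) (w : ends G).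

Lemma linked_trans X x y z : linked X x y -> linked X y z -> linked X x z.
Proof.
move=> [p [pp py pX]] [q [qp qz qX]]; exists (p ++ q); split.
- by rewrite cat_path pp py.
- by rewrite last_cat py.
- move=> t; rewrite -cat_cons mem_cat => /orP[/pX//|tq].
  by apply: qX; rewrite inE tq orbT.
Qed.

Lemma linked_sym X x y : linked X x y -> linked X y x.
Proof.
move=> [p [pp py pX]]; exists (rev (belast x p)); split.
- rewrite -py rev_path; apply: sub_path pp => a b; by rewrite adj_sym.
- by case: p py {pp pX} => [|a p] //= _; rewrite rev_cons last_rcons.
- move=> z; rewrite inE mem_rev => /orP[/eqP->|zp].
    by apply: pX; rewrite -py mem_last.
  by apply: pX; exact: mem_belast zp.
Qed.

Lemma linked_refl X x : X x -> linked X x x.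
Proof. by move=> Xx; exists [::]; split=> // z; rewrite inE => /eqP->. Qed.

Lemma linked_sub X Y x y : X `<=` Y -> linked X x y -> linked Y x y.
Proof. by move=> XY [p [? ? pX]]; exists p; split=> // z /pX/XY. Qed.

Lemma component_eq X C D z :
  is_component X C -> is_component X D -> C z -> D z -> C = D.
Proof.
move=> [x _ ->] [y _ ->] /= xz yz; apply/seteqP; split=> t /= h.
  exact: linked_trans yz (linked_trans (linked_sym xz) h).
exact: linked_trans xz (linked_trans (linked_sym yz) h).
Qed.

Lemma ray_avoid R X : finite_set X -> tail_in R (~` X).
Proof.
move=> finX.
have : finite_set (R @^-1` X).
  by apply: finite_preimage finX => a b _ _; exact: ray_inj.
move=> /finite_seqP[s sE].
exists (\max_(i <- s) i).+1 => m lem Xm.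
have ms : m \in s by have : [set` s] m by rewrite -sE.
by have := leq_trans lem (@leq_bigmax_seq _ s xpredT id m ms isT); rewrite ltnn.
Qed.

Lemma ray_linked R X n m : (forall k, (n <= k)%N -> X (R k)) ->
  (n <= m)%N -> linked X (R n) (R m).
Proof.
move=> RX; elim: m => [|m IH]; rewrite ?leqn0 => le.
  by rewrite (eqP le); apply/linked_refl; rewrite -(eqP le); exact: RX.
move: le; rewrite leq_eqVlt => /orP[/eqP<-|]; first exact/linked_refl/RX.
rewrite ltnS => nm; apply: linked_trans (IH nm) _.
exists [:: R m.+1]; split=> //=; first by rewrite ray_adj.
by move=> z; rewrite !inE => /orP[]/eqP->; apply: RX => //; exact: leqW.
Qed.

Lemma end_comp_ex X w : finite_set X ->
  exists C, is_component X C /\ forall R, end_rays w R -> tail_in R C.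
Proof.
move=> finX; case: w => w [R /= ->].
have [n nX] := ray_avoid R finX.
exists [set y | linked (~` X) (R n) y]; split; first by exists (R n) => //; exact: nX.
move=> S RS; have [m mX] := ray_avoid S finX.
exists m => k mk /=.
pose Z := X `|` (R @` `I_n `|` S @` `I_m).
have finZ : finite_set Z.
  by rewrite !finite_setU; split=> //; split; apply: finite_image; exact: finite_II.
have /existsNP[a /existsNP[b]] := RS Z finZ.
move=> /not_implyP[[i _ <-]] /not_implyP[[j _ <-]] /contrapT [p [pp pl pZ]].
have ni : (n <= i)%N.
  rewrite leqNgt; apply/negP => lt; have := pZ (R i); rewrite mem_head.
  by apply=> //; right; left; exists i.
have mj : (m <= j)%N.
  rewrite leqNgt; apply/negP => lt; have := pZ (S j); rewrite -{1}pl mem_last.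
  by apply=> //; right; right; exists j.
apply: (linked_trans (ray_linked nX ni)).
apply: (@linked_trans _ _ (S j)).
  by exists p; split=> // z /pZ nZ Xz; apply: nZ; left.
exact: linked_trans (linked_sym (ray_linked mX mj)) (ray_linked mX mk).
Qed.

Lemma end_compP X w : finite_set X ->
  is_component X (end_comp X w) /\ forall R, end_rays w R -> tail_in R (end_comp X w).
Proof.
move=> /(@end_comp_ex _ w)[C CP].
exact: (@xgetPex _ set0 [set C | is_component X C /\
  forall R, end_rays w R -> tail_in R C] (ex_intro _ C CP)).
Qed.

Lemma end_nonempty w : exists R, end_rays w R.
Proof.
case: w => w [R /= ->]; exists R => X finX sep.
have [n nX] := ray_avoid R finX.
apply: (sep (R n) (R n)); [by exists n|by exists n|].
by apply/linked_refl/nX.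
Qed.

Lemma end_comp_eq X C w R : finite_set X ->
  is_component X C -> end_rays w R -> tail_in R C -> end_comp X w = C.
Proof.
move=> finX compC wR [n nC]; have [compE /(_ R wR)[m mE]] := end_compP w finX.
apply: (@component_eq X _ _ (R (maxn n m))) => //.
  by apply: mE; rewrite leq_maxr.
by apply: nC; rewrite leq_maxl.
Qed.

Lemma end_comp_sub X Y w : finite_set X -> finite_set Y -> X `<=` Y ->
  end_comp Y w `<=` end_comp X w.
Proof.
move=> finX finY XY.
have [R wR] := end_nonempty w.
have [[x _ ->] /(_ R wR)[n nX]] := end_compP w finX.
have [[y _ ->] /(_ R wR)[m mY]] := end_compP w finY.
move=> z /= yz.
have yR := mY _ (leq_maxr n m); have xR := nX _ (leq_maxl n m).
have sub : ~` Y `<=` ~` X by exact: subsetC.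
apply: linked_trans xR _.
exact: linked_sub sub (linked_trans (linked_sym yR) yz).
Qed.

Lemma end_basic_cover : \bigcup_(XC in @end_basic_index G) end_basic XC = setT.
Proof.
apply/seteqP; split=> // w _; have fin0 : finite_set (@set0 G) by [].
by exists (set0, end_comp set0 w) => //; split=> //; have [] := end_compP w fin0.
Qed.

Lemma end_basic_join XC YD w : @end_basic_index G XC -> end_basic_index YD ->
  end_basic XC w -> end_basic YD w ->
  exists ZE, [/\ end_basic_index ZE, end_basic ZE w &
                 end_basic ZE `<=` end_basic XC `&` end_basic YD].
Proof.
case: XC YD => [X C] [Y D] [/= finX _] [/= finY _]; rewrite /end_basic /= => <- <-.
have finZ : finite_set (X `|` Y) by rewrite finite_setU.
exists (X `|` Y, end_comp (X `|` Y) w); split=> //=.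
  by split=> //; have [] := end_compP w finZ.
move=> v /= vw; have [R vR] := end_nonempty v.
have [_ /(_ R vR)[n nE]] := end_compP v finZ; rewrite vw in nE.
split; apply: (@end_comp_eq _ _ _ R) => //.
- by have [] := end_compP w finX.
- by exists n => m /nE; apply: end_comp_sub.
- by have [] := end_compP w finY.
- by exists n => m /nE; apply: end_comp_sub.
Qed.

End EndComponents.

HB.instance Definition _ (G : sgraph) :=
  isBaseTopological.Build (ends G) (@end_basic_cover G) (@end_basic_join G).

Definition is_tree (T : sgraph) : Prop :=
  gconnected T /\ forall c : seq T, (2 < size c)%N -> ~ ucycle (@adj T) c.

Record tree_decomposition (G T : sgraph) (V : T -> set G) : Prop := {
  td_tree : is_tree T;
  td_cover : \bigcup_t V t = [set: G];
  td_edge : forall x y : G, adj x y -> exists2 t, V t x & V t y;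
  td_path : forall (t1 t2 t3 : T) (p : seq T),
    path (@adj T) t1 p -> uniq (t1 :: p) -> last t1 p = t3 ->
    t2 \in t1 :: p -> V t1 `&` V t3 `<=` V t2 }.

Definition finite_adhesion (G T : sgraph) (V : T -> set G) : Prop :=
  forall s t : T, adj s t -> finite_set (V s `&` V t).

(* [T] is a K_{1,kappa} with centre [c], where kappa = #|T \ {c}|; once kappa
   is at least 2, its leaves are exactly the vertices other than [c]. *)
Definition is_star (T : sgraph) (c : T) : Prop :=
  forall s t : T, adj s t = (s != t) && ((s == c) || (t == c)).

Definition uncountable_star_decomposition (G T : sgraph) (c : T)
    (V : T -> set G) : Prop :=
  [/\ tree_decomposition V, is_star c & ~ countable (~` [set c])].

(* Some ray of [w] meets [A] infinitely often. For a part of a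
   tree-decomposition of finite adhesion, every ray of [w] then does. *)
Definition lives_in (G : sgraph) (w : ends G) (A : set G) : Prop :=
  exists2 R : ray G, end_rays w R & infinite_set (range R `&` A).

(* Main.v *)
Require Import Defs.
From mathcomp Require Import all_boot all_order.
From mathcomp Require Import all_classical all_analysis.

(* Call a connected set of vertices with finite boundary that contains a tail of
   a ray a region. An uncountable disjoint family of regions yields the
   star-decomposition, and conversely the leaf parts of such a decomposition
   yield disjoint basic open sets, one for each leaf.

   Suppose that every disjoint family of regions is countable. Close off to a
   countable vertex set U such that
   - for x in U, a maximal disjoint family of regions A with x outside A and its
     boundary has all its boundaries, and a vertex of each member, in U;
   - for finite Y in U, every component of G - Y that is a region meets U;
   - for finite Y in U, vertices of U linked in G - Y are linked in U - Y.
   Then every region A meets U: otherwise A lies in a component D of G - U. A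
   vertex x of N(D) outside N(A) would give a member A' of the family for x that
   meets A; as N(A') is in U, D lies in A', which contradicts that x is far from
   A'. Hence N(D) is contained in N(A) and finite, so D is a component of
   G - N(D) and meets U, a contradiction.
   The basic open sets given by finite subsets of U form a base: for finite X, put
   Y = X n U. Any two ends in the same component of G - Y have regions at X that
   meet U, say in u and u', and u, u' are linked in U - Y, which avoids X. *)

Set Implicit Arguments.
Unset Strict Implicit.
Unset Printing Implicit Defensive.

Local Open Scope classical_set_scope.

(** * Countable unions, towers of countable sets and disjoint open families *)

Lemma countable_setU T (A B : set T) :
  countable A -> countable B -> countable (A `|` B).
Proof.
move=> cA cB; rewrite -bigcup2E.
by apply: bigcup_countable => // -[|[|[|?]]] _.
Qed.

(** Gathers countably many countable witnesses in one set. Since [P i] need not pass to supersets,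
    each witness is kept as a subset [A]. *)
Lemma countable_choice I T (D : set I) (P : I -> set T -> Prop) :
  countable D ->
  (forall i, D i -> exists2 B, countable B & P i B) ->
  exists2 B, countable B & forall i, D i -> exists2 A, A `<=` B & P i A.
Proof.
move=> cD DP.
have [F FP] : exists F, forall i, D i -> countable (F i) /\ P i (F i).
  suff /choice[F FP] : forall i, exists B, D i -> countable B /\ P i B.
    by exists F.
  move=> i; have [/DP[B cB PB]|nDi] := pselect (D i); first by exists B.
  by exists set0.
exists (\bigcup_(i in D) F i).
  by apply: bigcup_countable => // i /FP[].
by move=> i Di; exists (F i); [exact: bigcup_sup|have [] := FP i Di].
Qed.

Lemma countable_tower T (Q : set T -> set T -> Prop) :
  (forall U, countable U -> exists2 U', countable U' & Q U U') ->
  exists W : nat -> set T, forall n, countable (W n) /\ Q (W n) (W n.+1).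
Proof.
move=> step.
have /choice[f fP] : forall U, exists U',
    countable U -> countable U' /\ Q U U'.
  move=> U; have [/step[U' cU' QU]|ncU] := pselect (countable U).
    by exists U'.
  (* An uncountable [U] gets a dummy value; the iteration never reaches one. *)
  by exists set0.
exists (fun n => iter n f set0) => n.
suff cW : countable (iter n f set0) by split=> //; have [] := fP _ cW.
by elim: n => [|n IH] //=; have [] := fP _ IH.
Qed.

Lemma nondecreasing_bigcup T (W : nat -> set T) :
  (forall n, W n `<=` W n.+1) -> forall m n, (m <= n)%N -> W m `<=` W n.
Proof.
move=> W1 m n /subnK <-; elim: (n - m)%N => [|k IH] //.
by rewrite addSn; apply: subset_trans IH (W1 _).
Qed.

Lemma finite_sub_bigcup (T : choiceType) (W : nat -> set T) (Y : set T) :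
  (forall n, W n `<=` W n.+1) -> finite_set Y -> Y `<=` \bigcup_n W n ->
  exists n, Y `<=` W n.
Proof.
move=> W1 /finite_seqP[s ->]; elim: s => [|x s IH] sub; first by exists 0%N.
have [n sn] : exists n, [set` s] `<=` W n.
  by apply: IH => z zs; apply: sub; rewrite /= inE zs orbT.
have [m _ Wx] : (\bigcup_n W n) x by apply: sub; rewrite /= inE eqxx.
exists (maxn m n) => z; rewrite /= inE => /orP[/eqP->|zs].
  by apply: nondecreasing_bigcup Wx => //; rewrite leq_maxl.
by apply: (nondecreasing_bigcup W1 (leq_maxr m n)); exact: sn.
Qed.

(** Each member contains a non-empty base set, and disjointness makes the choice of that base set
    injective. *)
Lemma disjoint_open_not_second_countable (T : topologicalType)
    (U : set (set T)) :
  (forall A, U A -> open A /\ A !=set0) -> trivIset U id ->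
  @second_countable T -> countable U.
Proof.
move=> UO tU [B cB [_ basB]].
have [f fP] : exists f : set T -> set T, forall A, U A ->
    [/\ B (f A), f A !=set0 & f A `<=` A].
  suff /choice[f fP] : forall A, exists b, U A -> [/\ B b, b !=set0 & b `<=` A].
    by exists f.
  move=> A; have [/UO[oA [x Ax]]|nU] := pselect (U A); last by exists set0.
  have [|b [Bb bx] bA] := basB x A; first exact: open_nbhs_nbhs.
  by exists b => _; split=> //; exists x.
move/countable_injP: cB => [g ginj]; apply/countable_injP; exists (g \o f).
move=> A C /set_mem UA /set_mem UC /= gAC.
have [BA [x Ax] fA] := fP A UA; have [BC _ fC] := fP C UC.
have fE : f A = f C by apply: ginj => //; exact: mem_set.
apply: tU => //; exists x; split; first exact: fA.
by apply: fC; rewrite -fE.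
Qed.

(** * Walks, boundaries and regions *)

Section Regions.
Variable G : sgraph.
Implicit Types (A B C D X Y U : set G) (R : ray G) (w v : ends G).

Lemma linked_ind A (S : set G) x y : S x ->
  (forall u z, S u -> A z -> adj u z -> S z) -> linked A x y -> S y.
Proof.
move=> Sx step [p [pp <- pA]]; elim: p x Sx pp pA => [|z p IH] x Sx //=.
move=> /andP[xz zp] pA; apply: IH => //.
  by apply: step Sx _ xz; apply: pA; rewrite !inE eqxx orbT.
by move=> t tp; apply: pA; rewrite inE tp orbT.
Qed.

Lemma linked_end A x y : linked A x y -> A y.
Proof. by move=> [p [_ <- pA]]; apply: pA; exact: mem_last. Qed.

Lemma linked_start A x y : linked A x y -> A x.
Proof. by move=> [p [_ _ pA]]; apply: pA; exact: mem_head. Qed.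

Lemma linked_step A x y z : linked A x y -> A z -> adj y z -> linked A x z.
Proof.
move=> xy Az yz; apply: (linked_trans xy).
exists [:: z]; split=> //=; first by rewrite yz.
by move=> t; rewrite !inE => /orP[]/eqP-> //; exact: linked_end xy.
Qed.

(** Every vertex of a walk in [A] is itself linked to [x], so the walk stays in the component of
    [x]; components are thus connected in themselves. *)
Lemma linked_within A x y :
  linked A x y -> linked [set z | linked A x z] x y.
Proof.
move=> xy; have Ax := linked_start xy.
apply: (@linked_ind A [set z | linked [set z | linked A x z] x z] x y) => //=.
  by apply: linked_refl; exact: linked_refl.
move=> u z xu Az uz; apply: (linked_step xu) (uz).
by apply: linked_step Az uz; exact: linked_end xu.
Qed.

Lemma linked_countable A x y :
  exists2 B, countable B & linked A x y -> linked (A `&` B) x y.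
Proof.
have [[p [pp pl pA]]|nxy] := pselect (linked A x y); last by exists set0.
exists [set` x :: p]; first exact/finite_set_countable/finite_seq.
by exists p; split=> // z zp; split=> //; exact: pA.
Qed.

(** The neighbourhood N(A). *)
Definition boundary A : set G := [set x | ~ A x /\ exists2 y, A y & adj x y].

Record region A : Prop := Region {
  region_finite : finite_set (boundary A);
  region_linked : forall x y, A x -> A y -> linked A x y;
  region_ray : exists R : ray G, tail_in R A }.

Lemma region_nonempty A : region A -> A !=set0.
Proof. by move=> [_ _ [R [n nA]]]; exists (R n); exact: nA. Qed.

Lemma boundary_component X C : is_component X C -> boundary C `<=` X.
Proof.
move=> [x _ ->] z [nxz [y xy zy]]; apply: contrapT => nXz; apply: nxz.
by apply: linked_step xy nXz _; rewrite adj_sym.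
Qed.

Lemma component_region X C R :
  finite_set X -> is_component X C -> tail_in R C -> region C.
Proof.
move=> finX compC RC; split; last by exists R.
  by apply: sub_finite_set finX; exact: boundary_component.
have [x _ ->] := compC; move=> y z /= /linked_within xy /linked_within xz.
exact: linked_trans (linked_sym xy) xz.
Qed.

Lemma end_comp_region X w : finite_set X -> region (end_comp X w).
Proof.
move=> finX; have [R wR] := end_nonempty w.
have [compC /(_ R wR) RC] := end_compP w finX.
exact: component_region finX compC RC.
Qed.

(** A walk leaving [A] has its first vertex outside [A] in the boundary of [A]. *)
Lemma linked_sub_boundary A D x y :
  boundary A `&` D = set0 -> A x -> linked D x y -> A y.
Proof.
move=> AD Ax; apply: linked_ind => // u z Au Dz uz; apply: contrapT => nAz.
suff : (boundary A `&` D) z by rewrite AD.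
by split=> //; split=> //; exists u => //; rewrite adj_sym.
Qed.

Lemma region_is_component A : region A -> is_component (boundary A) A.
Proof.
move=> rA; have [a Aa] := region_nonempty rA; exists a; first by case.
apply/seteqP; split=> [z Az|z] /=.
  by apply: linked_sub (region_linked rA Aa Az) => t At [].
by apply: linked_sub_boundary => //; exact: setICr.
Qed.

Definition end_of_ray R : ends G := End (ex_intro _ R erefl).

Lemma end_of_rayE R : end_rays (end_of_ray R) R.
Proof.
move=> X finX sep; have [n nX] := ray_avoid R finX.
by apply: (sep (R n) (R n)); [exists n|exists n|exact/linked_refl/nX].
Qed.

Lemma open_end_basic X C : finite_set X -> is_component X C ->
  open (end_basic (X, C)).
Proof.
move=> finX compC; exists [set (X, C)]; last by rewrite bigcup_set1.
by move=> _ ->.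
Qed.

Lemma open_ends_basic (O : set (ends G)) w : open O -> O w ->
  exists2 X, finite_set X & end_basic (X, end_comp X w) `<=` O.
Proof.
move=> [D' sub <-] [[X C] XC]; rewrite /end_basic /= => wC.
have [/= finX _] := sub _ XC; exists X => // v /= vC.
by exists (X, C) => //; exact: etrans vC wC.
Qed.

(** * Closing off a countable set of vertices *)

Definition countable_regions : Prop :=
  forall F : set (set G), F `<=` region -> trivIset F id -> countable F.

Definition far x A : Prop := ~ A x /\ ~ boundary A x.

(* Achieved by any [U] that contains the boundary and some vertex of each member
   of a maximal disjoint family of regions far from [x]. *)
Definition far_closed x U : Prop :=
  forall A, region A -> far x A -> A `&` U = set0 ->
    exists B, [/\ far x B, boundary B `<=` U & A `&` B !=set0].

Lemma far_closed_ex x : countable_regions ->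
  exists2 U, countable U & far_closed x U.
Proof.
move=> cR.
have [F [FR tF maxF]] :=
  ex_maximal_disjoint_subcollection id [set A | region A /\ far x A].
have cF : countable F by apply: cR => // A /FR[].
have [U cU UP] : exists2 U, countable U & forall A, F A ->
    exists2 V, V `<=` U & boundary A `<=` V /\ A `&` V !=set0.
  apply: countable_choice => // A /FR[rA _].
  have [a Aa] := region_nonempty rA; exists (boundary A `|` [set a]).
    apply: finite_set_countable; rewrite finite_setU.
    by split; [exact: region_finite|exact: finite_set1].
  by split; [exact: subsetUl|exists a; split=> //; right].
exists U => // A rA xA AU0; apply: contrapT => none.
(* Every member of [F] meets [U], which [A] does not. If [A] were also disjoint from all members,
   adding it would contradict maximality. *)
have AF : ~ F A.
  move=> /UP[V VU [_ [a [Aa Va]]]].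
  suff : (A `&` U) a by rewrite AU0.
  by split=> //; exact: VU.
apply: (maxF (A |` F)).
- by split=> [B FB|/(_ A)]; [right|move=> /(_ (or_introl erefl))].
- by move=> B [->|/FR].
- have dis B : F B -> A `&` B = set0.
    move=> FB; apply: contrapT => /eqP/set0P AB; apply: none; exists B.
    have [V VU [bV _]] := UP B FB.
    by split=> //; [have [] := FR B FB|exact: subset_trans VU].
  apply/trivIsetP => B C [->|FB] [->|FC] BC; rewrite ?eqxx // in BC *.
  + exact: dis.
  + by rewrite setIC; exact: dis.
  + by move/trivIsetP: tF; exact.
Qed.

Definition component_closed Y U : Prop :=
  forall D, is_component Y D -> region D -> D `&` U !=set0.

(** Distinct components of G - Y are disjoint, so only countably many are regions; one vertex of
    each suffices. *)
Lemma component_closed_ex Y : countable_regions ->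
  exists2 U, countable U & component_closed Y U.
Proof.
move=> cR; pose F := [set D | is_component Y D /\ region D].
have cF : countable F.
  apply: cR => [D []//|]; apply/trivIsetP => C D [cC _] [cD _] /eqP CD.
  apply/eqP/negPn/negP => /set0P[z [Cz Dz]]; apply: CD.
  exact: component_eq cC cD Cz Dz.
have [U cU UP] : exists2 U, countable U & forall D, F D ->
    exists2 V, V `<=` U & D `&` V !=set0.
  apply: countable_choice => // D [_ /region_nonempty[d Dd]].
  by exists [set d]; [exact: countable1|exists d].
exists U => // D cD rD; have [//|V VU [d [Dd Vd]]] := UP D.
by exists d; split=> //; exact: VU.
Qed.

Lemma countable_closure : countable_regions ->
  exists U, [/\ countable U, forall x, U x -> far_closed x U,
    forall Y, finite_set Y -> Y `<=` U -> component_closed Y U &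
    forall Y a b, finite_set Y -> Y `<=` U -> U a -> U b ->
      linked (~` Y) a b -> linked (U `\` Y) a b].
Proof.
move=> cR.
(* [V] answers all demands made by data from [U]. The answers [B] stay valid in larger sets, so the
   union of the tower inherits them. *)
pose Q U V := [/\ U `<=` V,
  forall x, U x -> exists2 B, B `<=` V & far_closed x B,
  forall Y, (Y `<=` U /\ finite_set Y) ->
    exists2 B, B `<=` V & component_closed Y B &
  forall q : set G * (G * G),
    ([set Y | Y `<=` U /\ finite_set Y] `*` (U `*` U)) q ->
    exists2 B, B `<=` V & (linked (~` q.1) q.2.1 q.2.2 ->
      linked (~` q.1 `&` B) q.2.1 q.2.2)].
have [W WP] : exists W : nat -> set G,
    forall n, countable (W n) /\ Q (W n) (W n.+1).
  apply: countable_tower => U cU.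
  have cfin := countable_finite_subset cU.
  have [V1 cV1 V1P] := countable_choice cU
    (fun x _ => far_closed_ex x cR).
  have [V2 cV2 V2P] := countable_choice cfin
    (fun Y _ => component_closed_ex Y cR).
  have [V3 cV3 V3P] := countable_choice
    (P := fun q B => linked (~` q.1) q.2.1 q.2.2 ->
      linked (~` q.1 `&` B) q.2.1 q.2.2)
    (countableX cfin (countableX cU cU))
    (fun q _ => linked_countable (~` q.1) q.2.1 q.2.2).
  exists (U `|` (V1 `|` (V2 `|` V3))); first by do !apply: countable_setU.
  split=> [|x /V1P[B BV PB]|Y /V2P[B BV PB]|q /V3P[B BV PB]].
  - exact: subsetUl.
  - by exists B => // z /BV; right; left.
  - by exists B => // z /BV; right; right; left.
  - by exists B => // z /BV; right; right; right.
have W1 n : W n `<=` W n.+1 by have [_ []] := WP n.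
exists (\bigcup_n W n); split.
- by apply: bigcup_countable => // n _; have [] := WP n.
- move=> x [n _ Wx] A rA xA AW.
  have [_ [_ /(_ x Wx)[B BW fB] _ _]] := WP n.
  have BU : B `<=` \bigcup_n W n by move=> z /BW; exists n.+1.
  have [|C [xC bC AC]] := fB A rA xA.
    by apply/seteqP; split=> // z [Az /BU Uz]; rewrite -AW.
  by exists C; split=> //; exact: subset_trans BU.
- move=> Y finY YU D cD rD.
  have [n Yn] := finite_sub_bigcup W1 finY YU.
  have [_ [_ _ /(_ Y (conj Yn finY))[B BW fB] _]] := WP n.
  have [d [Dd Bd]] := fB D cD rD.
  by exists d; split=> //; exists n.+1 => //; exact: BW.
- move=> Y a b finY YU Ua Ub ab.
  (* Joined into one finite set, [Y], [a] and [b] all occur at a single stage of the tower. *)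
  have finZ : finite_set (Y `|` [set a; b]).
    by rewrite !finite_setU; do !split=> //; exact: finite_set1.
  have ZU : Y `|` [set a; b] `<=` \bigcup_n W n by move=> z [/YU|[]->].
  have [n Zn] := finite_sub_bigcup W1 finZ ZU.
  have [_ [_ _ _ /(_ (Y, (a, b)))[]/=]] := WP n.
    split=> /=; first by split=> // z Yz; apply: Zn; left.
    by split; apply: Zn; right; [left|right].
  move=> B BW /(_ ab); apply: linked_sub => z [nYz Bz]; split=> //.
  by exists n.+1 => //; exact: BW.
Qed.

(** * A countable base from the closed set *)

Lemma closed_meets_region U A :
  (forall x, U x -> far_closed x U) ->
  (forall Y, finite_set Y -> Y `<=` U -> component_closed Y U) ->
  region A -> A `&` U !=set0.
Proof.
move=> farU compU rA; apply: contrapT => AU.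
have AU0 : A `&` U = set0 by apply: contrapT => /eqP/set0P.
have [a Aa] := region_nonempty rA.
have nU z : A z -> ~ U z by move=> Az Uz; apply: AU; exists z.
pose D := [set y | linked (~` U) a y].
have AD : A `<=` D.
  by move=> z Az; apply: linked_sub (region_linked rA Aa Az).
have cD : is_component U D by exists a => //; exact: nU.
have bDA : boundary D `<=` boundary A.
  move=> x bDx; apply: contrapT => nbA.
  have Ux := boundary_component cD bDx.
  have [|B [[nBx nbB] bBU [z [Az Bz]]]] := farU x Ux A rA _ AU0.
    by split=> // /nU.
  have [_ [y Dy xy]] := bDx.
  (* The neighbour [y] of [x] lies in [D]; were it in [B], then [x] would be in [B] or its
     boundary. *)
  suff By : B y by apply: nbB; split=> //; exists y.
  apply: (@linked_sub_boundary B (~` U) z y) => //.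
    by apply/seteqP; split=> // t [/bBU].
  exact: linked_trans (linked_sym (AD z Az)) Dy.
have finD : finite_set (boundary D).
  by apply: sub_finite_set bDA _; exact: region_finite.
have rD : region D.
  split=> //; last by have [R [n nA]] := region_ray rA; exists R, n => m /nA/AD.
  move=> y z /= /linked_within ay /linked_within az.
  exact: linked_trans (linked_sym ay) az.
have [] := compU _ finD (boundary_component cD) D (region_is_component rD) rD.
by move=> z [/linked_end].
Qed.

Lemma countable_regions_second_countable :
  countable_regions -> @second_countable (ends G).
Proof.
move=> /countable_closure[U [cU farU compU linkU]].
have meets A : region A -> A `&` U !=set0 by exact: closed_meets_region.
(* A component is named by one of its vertices in [U], so countably many pairs suffice. *)
pose base (q : set G * G) :=
  end_basic (q.1, [set y | linked (~` q.1) q.2 y]).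
pose I := ([set Y | Y `<=` U /\ finite_set Y] `*` U)
  `&` [set q | ~ q.1 q.2].
exists (base @` I).
  apply: (sub_countable (card_image_le _ _)).
  apply: (@sub_countable _ _ _ ([set Y | Y `<=` U /\ finite_set Y] `*` U)).
    by apply: subset_card_le => q [].
  by apply: countableX => //; exact: countable_finite_subset.
split=> [_ [[Y u] [[/= [_ finY] _] nYu] <-]|w O].
  by apply: open_end_basic => //; exists u.
rewrite nbhsE => -[V [oV Vw] VO].
have [X finX XV] := open_ends_basic oV Vw.
pose Y := X `&` U.
have finY : finite_set Y by exact: finite_setIl.
have YX : Y `<=` X by exact: subIsetl.
have [u [wu Uu]] := meets _ (end_comp_region w finX).
have [cX _] := end_compP w finX.
have [cY _] := end_compP w finY.
have nXu : ~ X u by have [x _ E] := cX; move: wu; rewrite E => /linked_end.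
have EY : end_comp Y w = [set y | linked (~` Y) u y].
  apply: (@component_eq _ Y _ _ u) => //.
  - by exists u => // /YX.
  - exact: end_comp_sub wu.
  - by apply: linked_refl => /YX.
exists (base (Y, u)) => /=.
  split=> //; exists (Y, u) => //.
  by split=> [|/YX//]; split=> //; split=> //; exact: subIsetr.
move=> v; rewrite /base /end_basic /= -EY => vw; apply/VO/XV.
have [u' [vu' Uu']] := meets _ (end_comp_region v finX).
rewrite /end_basic /=.
have [cX' _] := end_compP v finX.
apply: (component_eq cX' cX vu').
have YUu : end_comp Y v u' by exact: end_comp_sub vu'.
rewrite vw EY in YUu.
(* A walk in [U] that avoids [Y] avoids all of [X], because [Y] is the trace of [X] on [U]. *)
have uu' := linkU Y u u' finY (@subIsetr _ _ _) Uu Uu' YUu.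
have [x _ E] := cX; rewrite E /= in wu |- *.
apply: linked_trans wu _; apply: linked_sub uu' => z [Uz nYz] Xz.
exact: nYz.
Qed.

(** * The star-decomposition given by a disjoint family of regions *)

Section StarOfRegions.
Variable F : set (set G).
Hypothesis FR : F `<=` region.
Hypothesis tF : trivIset F id.

Definition star_vert : choiceType := option F.

Definition star_adj : rel star_vert :=
  fun s t => (s != t) && ((s == None) || (t == None)).

Lemma star_adj_sym : symmetric star_adj.
Proof. by move=> s t; rewrite /star_adj eq_sym orbC. Qed.

Lemma star_adj_irr : irreflexive star_adj.
Proof. by move=> s; rewrite /star_adj eqxx. Qed.

Definition star_graph : sgraph := SGraph star_adj_sym star_adj_irr.

(* Two regions may be adjacent, so the centre also receives all boundaries;
   its intersection with a region stays finite because [A] meets the boundary of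
   [B] only if [B] meets that of [A]. *)
Definition star_part (t : star_graph) : set G :=
  match t with
  | None => ~` (\bigcup_(A in F) A) `|` \bigcup_(A in F) boundary A
  | Some A => \val A `|` boundary (\val A)
  end.

Lemma disjoint_regions A B x : F A -> F B -> A x -> B x -> A = B.
Proof.
by move=> FA FB Ax Bx; apply: tF => //; exists x.
Qed.

Lemma star_part_centre (s t : star_graph) :
  s != t -> star_part s `&` star_part t `<=` star_part None.
Proof.
case: s t => [A|] [B|] AB x; [|by case|by case|by case].
have FA := set_valP A; have FB := set_valP B.
case=> -[Ax|bAx] [Bx|bBx]; last 3 first.
- by right; exists (\val B).
- by right; exists (\val A).
- by right; exists (\val A).
by case/eqP: AB; congr Some; apply: val_inj; exact: disjoint_regions Ax Bx.
Qed.

(** Every edge uses the centre, which a path visits at most once. This serves both acyclicity and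
    the path condition of the decomposition. *)
Lemma star_path (s t : star_graph) (p : seq star_graph) :
  path (@adj star_graph) s p -> uniq (s :: p) -> last s p = t ->
  [\/ p = [::], p = [:: t] | p = [:: None; t]].
Proof.
case: p => [|a [|b [|c p]]]; first by constructor 1.
- by move=> _ _ <-; constructor 2.
- rewrite /= /star_adj !inE !negb_or => /and3P[/andP[_ sa] /andP[_ ab] _].
  move=> /and3P[/andP[_ sb] _ _] <-; constructor 3.
  by case: a sa ab => [a|] //; case: s b sb => [s|] [b|].
rewrite /= /star_adj !inE !negb_or => /and4P[/andP[_ sa] /andP[_ ab] /andP[_ bc] _].
move=> /and4P[/andP[sNa /andP[sNb _]] /andP[aNb /andP[aNc _]] _ _].
by case: a sa ab sNa aNb aNc => [a|]; case: b bc sNb => [b|]; case: s => [s|];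
  case: c => [c|].
Qed.

Lemma star_is_tree : is_tree star_graph.
Proof.
split.
  split; first by exists None.
  have centre (t : star_graph) : linked [set: star_graph] None t.
    case: t => [A|]; last exact: linked_refl.
    by exists [:: Some A].
  by move=> s t; apply: linked_trans (centre t); exact: linked_sym (centre s).
move=> [|a [|b [|d p]]] // _ /andP[].
rewrite /cycle rcons_path => /andP[adp la] uabd.
(* Without its closing edge the cycle is a path, hence leaf, centre, leaf; the closing edge would
   join two leaves. *)
have := star_path (s := a) (p := [:: b, d & p]) adp uabd erefl.
case=> //= -[bE _ pE]; subst b p; move: la uabd; rewrite /= /star_adj !inE.
by case: a {adp} => [a|]; case: d => [d|]; rewrite /= ?eqxx ?andbF.
Qed.

Lemma star_decompositionP : tree_decomposition star_part.
Proof.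
split; first exact: star_is_tree.
- apply/seteqP; split=> // x _.
  have [[A FA Ax]|nx] := pselect ((\bigcup_(A in F) A) x).
    by exists (Some (SigSub (mem_set FA))) => //; left.
  by exists None => //; left.
- move=> x y xy; have yx : adj y x by rewrite adj_sym.
  have inA (A : F) (u z : G) : adj u z -> \val A u -> star_part (Some A) z.
    move=> uz Au; have [Az|nAz] := pselect (\val A z); first by left.
    by right; split=> //; exists u => //; rewrite adj_sym.
  have [[A FA Ax]|nx] := pselect ((\bigcup_(A in F) A) x).
    exists (Some (SigSub (mem_set FA))); first by left.
    exact: (inA (SigSub (mem_set FA)) x y xy Ax).
  have [[A FA Ay]|ny] := pselect ((\bigcup_(A in F) A) y).
    exists (Some (SigSub (mem_set FA))); last by left.
    exact: (inA (SigSub (mem_set FA)) y x yx Ay).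
  by exists None; left.
- move=> t1 t2 t3 p pp up lp; have := star_path pp up lp.
  case=> pE; subst p; rewrite !inE; last 1 first.
  + move=> /or3P[] /eqP-> => [|| x []//]; first exact: subIsetl.
    apply: star_part_centre; move: up.
    by rewrite /= !inE negb_or => /andP[/andP[]].
  + by move=> /eqP->; exact: subIsetl.
  + by move=> /orP[] /eqP->; [exact: subIsetl|exact: subIsetr].
Qed.

Lemma star_finite_adhesion : finite_adhesion star_part.
Proof.
have leaf (A : F) : finite_set (star_part (Some A) `&` star_part None).
  have FA := set_valP A; have [finA _ _] := FR FA.
  (* By disjointness at most one member of [F] contains [y]. *)
  have nearby y : finite_set (\bigcup_(B in [set B | F B /\ B y]) boundary B).
    have [[B [FB By]]|none] := pselect (exists B, F B /\ B y).
      apply: sub_finite_set (region_finite (FR FB)) => x [C [FC Cy]].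
      by rewrite (disjoint_regions FC FB Cy By).
    apply: (sub_finite_set _ (finite_set0 _)) => x [C FCy _].
    by apply: none; exists C.
  apply: (@sub_finite_set _ _ (boundary (\val A) `|`
      \bigcup_(y in boundary (\val A))
        \bigcup_(B in [set B | F B /\ B y]) boundary B)); last first.
    by rewrite finite_setU; split=> //; exact: bigcup_finite.
  move=> x [[Ax|] Nx]; [right|by left].
  (* A vertex [x] of [A] is in the centre only through the boundary of some [B]; its neighbour [y]
     in [B] is then one of the finitely many boundary vertices of [A]. *)
  case: Nx => [[]|[B FB [nBx [y By xy]]]]; first by exists (\val A).
  exists y; last by exists B => //; split=> //; exists y.
  split; last by exists x => //; rewrite adj_sym.
  by move=> Ay; apply: nBx; rewrite (disjoint_regions FB FA By Ay).
move=> [A|] [B|]; rewrite [adj _ _]/= /star_adj /= ?andbF // => _; first exact: (leaf A).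
by rewrite setIC; exact: (leaf B).
Qed.

Lemma star_leaf_end (t : star_graph) :
  t <> None -> exists w : ends G, lives_in w (star_part t).
Proof.
case: t => [A _|//]; have [_ _ [R [n nA]]] := FR (set_valP A).
exists (end_of_ray R), R; first exact: end_of_rayE.
move=> finA; have [m mA] := ray_avoid R finA.
apply: (mA (maxn n m)); first by rewrite leq_maxr.
by split; [exists (maxn n m)|left; apply: nA; rewrite leq_maxl].
Qed.

Lemma star_uncountable :
  ~ countable F -> ~ countable (~` [set None : star_graph]).
Proof.
move=> ncF cL; apply: ncF.
(* Sends each leaf back to its region, so [F] is covered by the image of the leaves; the value at
   the centre is arbitrary. *)
pose part (t : star_graph) : set G := if t is Some A then \val A else set0.
apply: (@sub_countable _ _ _ (part @` ~` [set None : star_graph])).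
  by apply: subset_card_le => A FA; exists (Some (SigSub (mem_set FA))).
exact: sub_countable (card_image_le _ _) cL.
Qed.

End StarOfRegions.

(** * Disjoint open sets from a star-decomposition *)

Section StarDecomposition.
Variables (T : sgraph) (c : T) (V : T -> set G).
Hypothesis decV : uncountable_star_decomposition c V.
Hypothesis finV : finite_adhesion V.

Lemma leaf_parts_meet s t :
  s <> c -> t <> c -> s <> t -> V s `&` V t `<=` V c.
Proof.
move=> sc tc st; have [dV star _] := decV.
apply: (td_path dV (p := [:: c; t])) => //=.
- rewrite !star !eqxx ?orbT !andbT.
  by apply/andP; split; apply/eqP => // /esym.
- rewrite !inE negb_or !andbT; apply/andP; split; last by apply/eqP => /esym.
  by apply/andP; split; apply/eqP.
- by rewrite !inE eqxx orbT.
Qed.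

(** A vertex of [V t] outside [V c] lies in no other part, so each edge at it stays in [V t]. A walk
    starting there can enter [V c] only through the adhesion set. *)
Lemma leaf_end_basic t w : t <> c -> lives_in w (V t) ->
  end_comp (V t `&` V c) w `<=` V t `\` V c.
Proof.
move=> tc [R wR infR]; have [dV star _] := decV.
set X := V t `&` V c.
have finX : finite_set X.
  by apply: finV; rewrite star eqxx orbT andbT; apply/eqP.
have [compC /(_ R wR)[n nC]] := end_compP w finX.
(* [R] meets [V t] infinitely often, hence also in the tail that lies in the component. *)
have [m [nm Rm]] : exists m, (n <= m)%N /\ V t (R m).
  apply: contrapT => none; apply: infR.
  apply: (sub_finite_set _ (finite_image R (finite_II n))) => x [[m _ <-] Vm].
  exists m => //=; rewrite ltnNge; apply/negP => nm; apply: none.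
  by exists m.
have [x _ E] := compC; have xm := nC m nm; rewrite E /= in xm *.
have nXm := linked_end xm.
move=> y xy; have my := linked_trans (linked_sym xm) xy.
apply: (@linked_ind (~` X) (V t `\` V c)) my.
  by split=> // Vc; apply: nXm.
move=> u z [Vu nVu] nXz uz.
have Vz : V t z.
  have [s Vsu Vsz] := td_edge dV uz.
  have [<-//|/eqP st] := eqVneq s t.
  have [sc|/eqP sc] := eqVneq s c; first by case: nVu; rewrite -sc.
  by case: nVu; apply: (leaf_parts_meet sc tc st).
by split=> // Vc; apply: nXz.
Qed.

Lemma uncountable_disjoint_open :
  (forall t, t <> c -> exists w : ends G, lives_in w (V t)) ->
  exists U : set (set (ends G)),
    [/\ ~ countable U, forall O, U O -> open O /\ O !=set0 & trivIset U id].
Proof.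
move=> live; have [_ star ncL] := decV.
have [w wP] : exists w : T -> ends G, forall t, t <> c -> lives_in (w t) (V t).
  (* Some leaf exists, and an end living in its part serves as the default value at the centre. *)
  have [t0 t0c] : (~` [set c]) !=set0.
    by apply/set0P/eqP => L0; apply: ncL; rewrite L0; exact: countable0.
  have [w0 _] := live t0 t0c.
  suff /choice[w wP] : forall t, exists w : ends G, t <> c -> lives_in w (V t).
    by exists w.
  move=> t; have [tc|tc] := pselect (t = c); first by exists w0.
  by have [w wt] := live t tc; exists w.
pose X t := V t `&` V c.
pose O t := end_basic (X t, end_comp (X t) (w t)).
have finX t : t <> c -> finite_set (X t).
  by move=> tc; apply: finV; rewrite star eqxx orbT andbT; apply/eqP.
have disj s t v : s <> c -> t <> c -> O s v -> O t v -> s = t.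
  move=> sc tc; rewrite /O /end_basic /= => Os Ot; apply: contrapT => st.
  have [R vR] := end_nonempty v.
  have [_ /(_ R vR)[n nC]] := end_compP v (finX s sc).
  have [_ /(_ R vR)[m mC]] := end_compP v (finX t tc).
  have := nC (maxn n m) (leq_maxl _ _); have := mC (maxn n m) (leq_maxr _ _).
  (* A late vertex on a ray of [v] would lie in both leaf parts but outside [V c]. *)
  rewrite Os Ot => /(leaf_end_basic tc (wP t tc))[Vt nVc].
  move=> /(leaf_end_basic sc (wP s sc))[Vs _].
  by apply: nVc; apply: (leaf_parts_meet sc tc st).
have self t : O t (w t) by [].
exists (O @` ~` [set c]); split.
- move=> /countable_injP[f finj]; apply: ncL; apply/countable_injP.
  exists (f \o O) => s t /set_mem sc /set_mem tc /= fst.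
  have OE : O s = O t by apply: finj => //; apply/mem_set; [exists s|exists t].
  by apply: (disj s t (w s)) => //; rewrite -OE.
- move=> _ [t tc <-]; split; last by exists (w t).
  by apply: open_end_basic; [exact: finX|have [] := end_compP (w t) (finX t tc)].
- by move=> _ _ [s sc <-] [t tc <-] [v [Os Ot]]; rewrite (disj s t v).
Qed.

End StarDecomposition.

End Regions.

Theorem theorem4p4 (G : sgraph) (hG : gconnected G) :
  let star_decomposable :=
    exists (T : sgraph) (c : T) (V : T -> set G),
      [/\ uncountable_star_decomposition c V,
          finite_adhesion V &
          forall t : T, t <> c -> exists w : ends G, lives_in w (V t)] in
  (~ @second_countable (ends G) <-> star_decomposable) /\
  (star_decomposable ->
     exists U : set (set (ends G)),
       [/\ ~ countable U,
           forall A, U A -> open A /\ A !=set0 &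
           trivIset U id]).
Proof.
move=> star_decomposable.
have disj : star_decomposable -> exists U : set (set (ends G)),
    [/\ ~ countable U, forall A, U A -> open A /\ A !=set0 & trivIset U id].
  by move=> [T [c [V [decV finV live]]]]; exact: uncountable_disjoint_open decV _ _.
split=> //; split; last first.
  move=> /disj[U [ncU UO tU]] scG; apply: ncU.
  exact: disjoint_open_not_second_countable UO tU scG.
(* Without a countable base some disjoint family [F] of regions is uncountable, and its star is the
   decomposition sought. *)
move=> nsc; have /existsNP[F] : ~ countable_regions G.
  by move=> /countable_regions_second_countable.
move=> /not_implyP[FR /not_implyP[tF ncF]].
exists (star_graph F), None, (@star_part G F); split.
- split; [exact: star_decompositionP|by []|exact: star_uncountable].
- exact: star_finite_adhesion.
- exact: star_leaf_end.
Qed.
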